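(* Let $D$ be a weighted oriented graph consisting of two unbalanced cycles $\mathcal C_m,\mathcal C_n$ (of lengths $m$ and $n$) which share only a single vertex, labelled as follows: $V(\mathcal C_m)=\{v_1,\dots,v_m\}$, $V(\mathcal C_n)=\{v_1,v_{m+1},\dots,v_{m+n-1}\}$, $E(\mathcal C_m)=\{e_1,\dots,e_m\}$, $E(\mathcal C_n)=\{e_{m+1},\dots,e_{m+n}\}$, where $e_i$ is incident with $v_i,v_{i+1}$ for $1\le i\le m-1$, $e_m$ with $v_m,v_1$, $e_{m+1}$ with $v_1,v_{m+1}$, $e_{m+i}$ with $v_{m+i-1},v_{m+i}$ for $2\le i\le n-1$, and $e_{m+n}$ with $v_{m+n-1},v_1$. Let $A(\mathcal C_m)$ have rows ordered $v_1,\dots,v_m$ and columns ordered $e_1,\dots,e_m$, and let $A(\mathcal C_n)$ have rows ordered $v_1,v_{m+1},\dots,v_{m+n-1}$ and columns ordered $e_{m+1},\dots,e_{m+n}$. Then $I_D$ is generated by the primitive binomial $f_{\mathbf c_m\cup\mathbf c_n}$, where $$\mathbf c_m\cup\mathbf c_n=\frac1d\Big(\big((-1)^{i+1}p\,M_{m-1}(A(\mathcal C_m)[1|i])\big)_{i=1}^m,\ \big((-1)^{i}q\,M_{n-1}(A(\mathcal C_n)[1|i])\big)_{i=1}^n\Big)\in\mathbb Z^{m+n},$$ with $p=\det A(\mathcal C_n)$, $q=\det A(\mathcal C_m)$ and $$d=\gcd\Big(\big(|p|M_{m-1}(A(\mathcal C_m)[1|i])\big)_{i=1}^m,\ \big(|q|M_{n-1}(A(\mathcal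 C_n)[1|i])\big)_{i=1}^n\Big).$$
   Context: $K$ is a field. A weighted oriented graph $D=(V(D),E(D),\mathbf w)$ is a finite graph without loops or parallel edges, each edge being given an orientation ($(x,y)$ denotes an edge from $x$ to $y$), together with a weight function $\mathbf w:V(D)\to\{1,2,\dots\}$. Its incidence matrix $A(D)$ has rows indexed by vertices and columns by edges; the entry in row $x$ and column $e$ is $1$ if $e=(x,y)$ for some $y$, $\mathbf w(x)$ if $e=(y,x)$ for some $y$, and $0$ otherwise. The toric ideal $I_D$ is the kernel of the $K$-algebra homomorphism $K[e: e\in E(D)]\to K[x: x\in V(D)]$ sending $e=(x,y)$ to $x\,y^{\mathbf w(y)}$. Cycles in $D$ are cycles of the underlying undirected graph, with inherited orientations and weights (so each cycle has its own square incidence matrix). An (even) cycle $\mathcal C$ is balanced if $\det A(\mathcal C)=0$; a cycle that is not balanced is unbalanced (odd cycles always have nonzero determinant). For a matrix $A$, $M_k(A[i_1,\dots|j_1,\dots])$ denotes the $k\times k$ minor (determinant) obtained from $A$ by deleting rows $i_1,\dots$ and columns $j_1,\dots$. For $\mathbf b\in\mathbb Z^N$ (with $N$ the number of edges), $f_{\mathbf b}=\prod_{b_i>0}e_i^{b_i}-\prod_{b_i<0}e_i^{-b_i}$. A nonzero binomial $\mathbf e^{\mathbf u}-\mathbf e^{\mathbf v}\in I_D$ is primitive if there is no other nonzero binomial $\mathbf e^{\mathbf u'}-\mathbf e^{\mathbf v'}\in I_D$ with $\mathbf e^{\mathbf u'}\mid\mathbf e^{\mathbf u}$ and $\mathbf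 e^{\mathbf v'}\mid\mathbf e^{\mathbf v}$. *)

(* Defs.v *)
From HB Require Import structures.
From mathcomp Require Export all_boot all_order all_algebra.
From mathcomp.multinomials Require Export mpoly.

Set Implicit Arguments.
Unset Strict Implicit.
Unset Printing Implicit Defensive.

Import Order.TTheory GRing.Theory Num.Theory.
Local Open Scope ring_scope.

(* The edge e is oriented from src e to tgt e. The condition [no_parallel]     *)
(* compares unordered endpoints, so it also rules out opposite edges.          *)
Record wograph (s t : nat) := WOGraph {
  src : 'I_t -> 'I_s;
  tgt : 'I_t -> 'I_s;
  wt : 'I_s -> nat;
  no_loop : forall e, src e != tgt e;
  no_parallel :
    forall e f, [set src e; tgt e] = [set src f; tgt f] -> e = f;
  wt_gt0 : forall x, (0 < wt x)%N
}.

Definition incidence (s t : nat) (D : wograph s t) : 'M[int]_(s, t) :=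
  \matrix_(x, e)
    if x == src D e then 1 else if x == tgt D e then (wt D x)%:Z else 0.

Definition toric_map (K : fieldType) (s t : nat) (D : wograph s t)
    (P : {mpoly K[t]}) : {mpoly K[s]} :=
  P \mPo [tuple 'X_(src D e) * 'X_(tgt D e) ^+ wt D (tgt D e) | e < t].

Definition toric_ideal (K : fieldType) (s t : nat) (D : wograph s t) :
    {pred {mpoly K[t]}} :=
  fun P => toric_map D P == 0.

Arguments toric_ideal K {s t} D _.

Definition principal_ideal (K : fieldType) (t : nat) (f P : {mpoly K[t]}) :
    Prop :=
  exists Q : {mpoly K[t]}, P = Q * f.

Definition binom_of (K : fieldType) (t : nat) (b : 'rV[int]_t) :
    {mpoly K[t]} :=
  \prod_(i < t | 0 < b 0 i) 'X_i ^+ absz (b 0 i)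
  - \prod_(i < t | b 0 i < 0) 'X_i ^+ absz (b 0 i).

Definition primitive_binomial (K : fieldType) (s t : nat) (D : wograph s t)
    (f : {mpoly K[t]}) : Prop :=
  exists u v : 'X_{1..t},
    [/\ f = 'X_[u] - 'X_[v], f != 0, f \in toric_ideal K D
      & forall u' v' : 'X_{1..t},
          let g : {mpoly K[t]} := 'X_[u'] - 'X_[v'] in
          g != 0 -> g \in toric_ideal K D ->
          (u' <= u)%MM -> (v' <= v)%MM -> g = f].

(* vs and es list the vertices and the edges along the cycle: es i joins vs i  *)
(* to its cyclic successor, in either direction.                               *)
Definition is_cycle (s t : nat) (D : wograph s t) (k : nat)
    (vs : 'I_k -> 'I_s) (es : 'I_k -> 'I_t) : Prop :=
  [/\ (2 < k)%N, injective vs, injective es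
    & forall i, [set src D (es i); tgt D (es i)] = [set vs i; vs (ordS i)]].

Definition cycle_incidence (s t : nat) (D : wograph s t) (k : nat)
    (vs : 'I_k -> 'I_s) (es : 'I_k -> 'I_t) : 'M[int]_k :=
  mxsub vs es (incidence D).

Definition balanced (s t : nat) (D : wograph s t) (k : nat)
    (vs : 'I_k -> 'I_s) (es : 'I_k -> 'I_t) : Prop :=
  \det (cycle_incidence D vs es) = 0.

(* M_(k-1)(A[i|j]): unsigned, unlike [cofactor]. *)
Definition minor_del (k : nat) (A : 'M[int]_k) (i j : 'I_k) : int :=
  \det (row' i (col' j A)).

Definition gcd_row (k : nat) (b : 'rV[int]_k) : int :=
  \big[gcdz/0]_(i < k) b 0 i.

Definition ord_first (k : nat) (hk : (2 < k)%N) : 'I_k :=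
  Ordinal (ltnW (ltnW hk)).

(* Vertices v_1, ..., v_(m+n-1) and edges e_1, ..., e_(m+n) are numbered from  *)
(* 0 in 'I_(m + n.-1) and 'I_(m + n). The first cycle uses v_1, ..., v_m; the  *)
(* second one v_1, v_(m+1), ..., v_(m+n-1), in this order.                     *)
Definition vertex_Cm (m n : nat) (i : 'I_m) : 'I_(m + n.-1) := lshift n.-1 i.

Definition vertex_Cn (m n : nat) (hm : (2 < m)%N) (hn : (2 < n)%N)
    (j : 'I_n) : 'I_(m + n.-1) :=
  if unlift (ord_first hn) j is Some j' then rshift m j'
  else lshift n.-1 (ord_first hm).

Definition edge_Cm (m n : nat) (i : 'I_m) : 'I_(m + n) := lshift n i.

Definition edge_Cn (m n : nat) (j : 'I_n) : 'I_(m + n) := rshift m j.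

(* Main.v *)
Require Import Defs.
From mathcomp Require Import all_boot all_order all_algebra.
From mathcomp.multinomials Require Import mpoly.
From mathcomp Require Import zify ring.

Import Order.TTheory GRing.Theory Num.Theory.
Local Open Scope ring_scope.

(* The toric ideal is spanned by the binomials 'X_[u] - 'X_[v] with A u = A v, *)
(* A being the incidence matrix of D. A vector is in the kernel of A exactly   *)
(* when the two cycle matrices send its two halves to a and -a times the       *)
(* common vertex v_1. Multiplying by the adjugates shows that this kernel is   *)
(* the line through b, hence Z c with c the primitive vector b / d. If         *)
(* u - v = k c with k >= 0, then u = w + k c^+ and v = w + k c^-, so           *)
(* 'X_[u] - 'X_[v] is a monomial times a difference of k-th powers, which is   *)
(* a multiple of f_c.                                                          *)

(** The whole theorem rests on [spans_kernel D c]: the integer kernel of the incidence matrix is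
    exactly Z c. For any weighted oriented graph this makes [binom_of K c] a generator
    ([toric_ideal_binom_of]) and, when c is nonzero, primitive ([binom_of_primitive]). For the glued
    cycles, b lies in the kernel ([glued_kernel_adj]), and nonzero determinants confine the kernel
    to the rational line through b ([glued_kernel_line]). A Bezout relation among the entries of c =
    b / d then rules out non-integral multiples of c ([spans_kernel_primitive]). *)

Definition toric_exp {s t : nat} (D : wograph s t) (u : 'X_{1..t}) :
    'X_{1..s} :=
  (\sum_(e < t) (U_(src D e) + U_(tgt D e) *+ wt D (tgt D e)) *+ u e)%MM.

Lemma toric_expE (s t : nat) (D : wograph s t) (u : 'X_{1..t}) (x : 'I_s) :
  (toric_exp D u x)%:Z = \sum_(e < t) incidence D x e * (u e)%:Z.
Proof.
rewrite mnm_sumE (big_morph Posz PoszD (erefl _)); apply: eq_bigr => e _.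
rewrite mulmnE mnmDE mulmnE !mnm1E mxE (eq_sym x) (eq_sym x).
(* Without loops, source and target contribute to different rows, so their sum agrees with the
   nested [if] of [incidence]. *)
have := no_loop D e; case: (src D e =P x) => [<-|_].
  by rewrite eq_sym => /negPf ->; lia.
by case: (tgt D e =P x) => [<-|_]; lia.
Qed.

Lemma toric_exp_eq (s t : nat) (D : wograph s t) (u v : 'X_{1..t}) :
  toric_exp D u = toric_exp D v <->
  incidence D *m (\col_e ((u e)%:Z - (v e)%:Z)) = 0.
Proof.
have E x : (incidence D *m (\col_e ((u e)%:Z - (v e)%:Z))) x 0 =
    (toric_exp D u x)%:Z - (toric_exp D v x)%:Z.
  rewrite !toric_expE mxE -sumrB; apply: eq_bigr => e _.
  by rewrite !mxE mulrBr.
split=> [uv|uv0].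
  by apply/colP => x; rewrite E uv subrr mxE.
apply/mnmP => x; apply/eqP; rewrite -eqz_nat -subr_eq0 -E uv0 mxE.
by [].
Qed.

Lemma toric_mapX (K : fieldType) (s t : nat) (D : wograph s t)
    (u : 'X_{1..t}) :
  toric_map D 'X_[u] = 'X_[toric_exp D u] :> {mpoly K[s]}.
Proof.
rewrite /toric_map comp_mpolyX.
rewrite (big_morph (fun m => 'X_[m] : {mpoly K[s]})
  (@mpolyXD _ _) (mpolyX0 _ _)).
apply: eq_bigr => e _; rewrite tnth_mktuple.
by rewrite !mpolyXn -mpolyXD mpolyXn.
Qed.

Lemma mpolyX_eq (K : fieldType) (t : nat) (u v : 'X_{1..t}) :
  ('X_[u] == 'X_[v] :> {mpoly K[t]}) = (u == v).
Proof.
apply/eqP/eqP => [/(congr1 (mcoeff u))|-> //].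
by rewrite !mcoeffX eqxx; case: eqP => // _ /eqP; rewrite oner_eq0.
Qed.

Lemma binomial_in_toric_ideal (K : fieldType) (s t : nat) (D : wograph s t)
    (u v : 'X_{1..t}) :
  ('X_[u] - 'X_[v] \in toric_ideal K D) = (toric_exp D u == toric_exp D v).
Proof.
rewrite unfold_in /toric_ideal /toric_map comp_mpolyB -!/(toric_map _ _).
by rewrite !toric_mapX subr_eq0 mpolyX_eq.
Qed.

(** Reduces generation to binomials: [toric_map] merges monomials exactly along the fibres of
    [toric_exp]. *)
Lemma toric_ideal_generated (K : fieldType) (s t : nat) (D : wograph s t)
    (f : {mpoly K[t]}) :
  f \in toric_ideal K D ->
  (forall u v : 'X_{1..t}, toric_exp D u = toric_exp D v ->
     principal_ideal f ('X_[u] - 'X_[v])) ->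
  forall P, P \in toric_ideal K D <-> principal_ideal f P.
Proof.
move=> fI fgen P; split; last first.
  case=> Q ->; move: fI; rewrite !unfold_in /toric_ideal /toric_map.
  by rewrite rmorphM /= => /eqP ->; rewrite mulr0.
(* Replacing each monomial of P by a representative of its fibre changes P    *)
(* by binomials only, and kills P because its coefficients sum to 0 on fibres. *)
pose r u := choose (fun u' => toric_exp D u' == toric_exp D u) u.
have rE u : toric_exp D (r u) = toric_exp D u.
  by apply/eqP; apply: (@chooseP _ (fun u' => toric_exp D u' == _)).
(* [choose] depends only on the predicate, not on the witness supplied, so [r] is constant on
   fibres. *)
have r_eq u v : toric_exp D u = toric_exp D v -> r u = r v.
  move=> uv; rewrite /r uv.
  by apply: (@choose_id _ (fun u' => toric_exp D u' == _)); rewrite ?uv.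
move=> /eqP PI.
have sum0 : \sum_(u <- msupp P) P@_u *: 'X_[r u] = 0 :> {mpoly K[t]}.
  apply/mpolyP => v; rewrite raddf_sum mcoeff0 /=.
  have [rv|rv] := eqVneq (r v) v; last first.
    apply: big1 => u _; rewrite mcoeffZ mcoeffX; case: eqP => [uv|]; last first.
      by rewrite mulr0.
    by case/eqP: rv; rewrite -uv; apply: r_eq; rewrite rE.
  (* For a representative [v], both coefficients are the sum of the coefficients of [P] over the
     fibre of [v]. *)
  transitivity (toric_map D P)@_(toric_exp D v); last first.
    by rewrite PI mcoeff0.
  rewrite /toric_map comp_mpolyEX raddf_sum /=.
  apply: eq_bigr => u _; rewrite !mcoeffZ.
  rewrite -/(toric_map _ _) toric_mapX !mcoeffX.
  congr (_ * _%:R); congr nat_of_bool.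
  by apply/eqP/eqP => [<-|/r_eq ->]; rewrite ?rE.
have -> : P = \sum_(u <- msupp P) P@_u *: ('X_[u] - 'X_[r u]).
  by under eq_bigr do rewrite scalerBr; rewrite sumrB sum0 subr0 -mpolyE.
apply: big_ind => [|_ _ [Q1 ->] [Q2 ->]|u _].
- by exists 0; rewrite mul0r.
- by exists (Q1 + Q2); rewrite mulrDl.
- have [Q ->] := fgen u (r u) (esym (rE u)).
  by exists (P@_u *: Q); rewrite scalerAl.
Qed.

(** * Toric ideals whose exponent lattice is a line *)

Definition pos_part {t : nat} (c : 'rV[int]_t) : 'X_{1..t} :=
  [multinom (if 0 < c 0 i then absz (c 0 i) else 0%N)%R | i < t].

Lemma pos_partE (t : nat) (c : 'rV[int]_t) (i : 'I_t) :
  pos_part c i = if 0 < c 0 i then absz (c 0 i) else 0%N.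
Proof. exact: mnmE. Qed.

Lemma pos_partNE (t : nat) (c : 'rV[int]_t) (i : 'I_t) :
  pos_part (- c) i = if c 0 i < 0 then absz (c 0 i) else 0%N.
Proof. by rewrite mnmE mxE oppr_gt0 abszN. Qed.

Lemma binom_ofE (K : fieldType) (t : nat) (c : 'rV[int]_t) :
  binom_of K c = 'X_[pos_part c] - 'X_[pos_part (- c)].
Proof.
rewrite /binom_of !mpolyXE_id; congr (_ - _); rewrite big_mkcond /=.
  by apply: eq_bigr => i _; rewrite pos_partE; case: ifP.
by apply: eq_bigr => i _; rewrite pos_partNE; case: ifP.
Qed.

Lemma pos_partB (t : nat) (c : 'rV[int]_t) (i : 'I_t) :
  (pos_part c i)%:Z - (pos_part (- c) i)%:Z = c 0 i.
Proof. by rewrite pos_partE pos_partNE; case: ifP; case: ifP; lia. Qed.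


Definition spans_kernel {s t : nat} (D : wograph s t) (c : 'rV[int]_t) : Prop :=
  forall x : 'cV[int]_t, incidence D *m x = 0 <-> exists k, x = k *: c^T.

Lemma toric_exp_eq_line {s t : nat} {D : wograph s t} {c : 'rV[int]_t}
    (ker_c : spans_kernel D c) (u v : 'X_{1..t}) :
  toric_exp D u = toric_exp D v <->
  exists k : int, forall i, (u i)%:Z - (v i)%:Z = k * c 0 i.
Proof.
rewrite toric_exp_eq ker_c; split=> -[k uvk]; exists k.
  by move=> i; move/colP/(_ i): uvk; rewrite !mxE.
by apply/colP => i; rewrite !mxE uvk.
Qed.

Lemma binom_of_toric (K : fieldType) (s t : nat) (D : wograph s t)
    (c : 'rV[int]_t) :
  spans_kernel D c -> binom_of K c \in toric_ideal K D.
Proof.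
move=> ker_c; rewrite binom_ofE binomial_in_toric_ideal.
apply/eqP/(toric_exp_eq_line ker_c).
by exists 1 => i; rewrite pos_partB mul1r.
Qed.

Lemma toric_binomial_divisible (K : fieldType) (s t : nat) (D : wograph s t)
    (c : 'rV[int]_t) (u v : 'X_{1..t}) :
  spans_kernel D c -> toric_exp D u = toric_exp D v ->
  principal_ideal (binom_of K c) ('X_[u] - 'X_[v]).
Proof.
(* A negative multiple of c becomes positive after exchanging [u] and [v]; the sign goes into the
   cofactor. *)
move=> ker_c; suff nonneg (k : nat) (u1 v1 : 'X_{1..t}) :
    (forall i, (u1 i)%:Z - (v1 i)%:Z = k%:Z * c 0 i) ->
    principal_ideal (binom_of K c) ('X_[u1] - 'X_[v1]).
  move/(toric_exp_eq_line ker_c) => [[k|k] uvk]; first exact: nonneg uvk.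
  have [i|Q QE] := nonneg k.+1 v u.
    by rewrite -opprB uvk NegzE mulNr opprK.
  by exists (- Q); rewrite mulNr -QE opprB.
(* The truncated subtraction is exact: u1 = v1 + k c is at least k c, and u1 is nonnegative. *)
move=> uvk; pose w := (u1 - pos_part c *+ k)%MM.
have -> : u1 = (w + pos_part c *+ k)%MM.
  rewrite submK //; apply/mnm_lepP => i; rewrite mulmnE pos_partE.
  by move: (uvk i); case: ifP; nia.
have -> : v1 = (w + pos_part (- c) *+ k)%MM.
  apply/mnmP => i; rewrite mnmDE mnmBE !mulmnE pos_partE pos_partNE.
  by move: (uvk i); case: ifP; case: ifP; nia.
rewrite !mpolyXD -!mpolyXn -mulrBr subrXX -binom_ofE mulrCA.
by eexists; rewrite mulrC.
Qed.

Lemma toric_ideal_binom_of (K : fieldType) (s t : nat) (D : wograph s t)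
    (c : 'rV[int]_t) (P : {mpoly K[t]}) :
  spans_kernel D c ->
  P \in toric_ideal K D <-> principal_ideal (binom_of K c) P.
Proof.
move=> ker_c; apply: toric_ideal_generated; first exact: binom_of_toric.
by move=> u v; apply: toric_binomial_divisible.
Qed.

(** A binomial dividing this one termwise has exponent difference k c with k nonzero. Its two
    exponents inherit the disjoint supports of the two parts of c, so k is positive; the upper
    bounds then leave only k = 1. *)
Lemma binom_of_primitive (K : fieldType) (s t : nat) (D : wograph s t)
    (c : 'rV[int]_t) :
  spans_kernel D c -> c != 0 -> primitive_binomial D (binom_of K c).
Proof.
move=> ker_c c0; exists (pos_part c), (pos_part (- c)).
have [j cj] : exists j, c 0 j != 0.
  by case/rV0Pn: c0 => j; exists j.
split; [exact: binom_ofE| |exact: binom_of_toric|].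
  rewrite binom_ofE subr_eq0 mpolyX_eq; apply: contra cj => /eqP cE.
  by rewrite -pos_partB cE subrr.
move=> u v /=; rewrite binomial_in_toric_ideal subr_eq0 mpolyX_eq => uv.
move=> /eqP/(toric_exp_eq_line ker_c) [k uvk] /mnm_lepP uc /mnm_lepP vc.
have {}uc i := uc i; have {}vc i := vc i.
have k0 : k != 0.
  apply: contra uv => /eqP k0; apply/eqP/mnmP => i.
  by move: (uvk i); rewrite k0; lia.
have kpos : 0 < k.
  rewrite lt_neqAle eq_sym k0 /= leNgt; apply/negP => kneg.
  move: (uvk j) (uc j) (vc j); rewrite pos_partE pos_partNE.
  by case: ifP; case: ifP; nia.
rewrite binom_ofE; congr ('X_[_] - 'X_[_]); apply/mnmP => i;
  by move: (uvk i) (uc i) (vc i); rewrite pos_partE pos_partNE;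
  case: ifP; case: ifP; nia.
Qed.

(** * Bezout relations, and from a rational line to its integer points *)

Lemma gcd_row_dvd {k : nat} (b : 'rV[int]_k) (i : 'I_k) :
  (gcd_row b %| b 0%R i)%Z.
Proof.
rewrite /gcd_row; move: (mem_index_enum i).
elim: (index_enum _) => //= j r IH; rewrite inE big_cons => /orP[/eqP <-|/IH].
  exact: dvdz_gcdl.
exact/dvdz_trans/dvdz_gcdr.
Qed.

Lemma gcd_row_bezout {k : nat} (b : 'rV[int]_k) :
  exists w : 'I_k -> int, \sum_(i < k) w i * b 0 i = gcd_row b.
Proof.
rewrite /gcd_row; apply: (big_ind
  (fun g => exists w, \sum_(i < k) w i * b 0 i = g)) =>
  [|_ _ [w1 <-] [w2 <-]|i _].
- by exists (fun=> 0); rewrite big1 // => i _; rewrite mul0r.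
- set g1 := \sum_i _; set g2 := \sum_i _.
  have [a1 [a2 <-]] := Bezoutz g1 g2.
  exists (fun i => a1 * w1 i + a2 * w2 i).
  under eq_bigr do rewrite mulrDl -!mulrA.
  by rewrite big_split -!mulr_sumr.
- exists (fun j => (j == i)%:R); rewrite (bigD1 i) //= eqxx mul1r big1 ?addr0 //.
  by move=> j /negPf ->; rewrite mul0r.
Qed.

(** Pairing r x = a d c with [w] gives r (w . x) = a d, hence r x = r (w . x) c; cancelling r
    exhibits x as the integer multiple w . x of c. *)
Lemma spans_kernel_primitive {s t : nat} {D : wograph s t} {b c : 'rV[int]_t}
    (d r : int) (w : 'I_t -> int) :
  r != 0 -> d != 0 -> b = d *: c -> \sum_(i < t) w i * c 0 i = 1 ->
  incidence D *m b^T = 0 ->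
  (forall x : 'cV[int]_t, incidence D *m x = 0 -> exists a, r *: x = a *: b^T) ->
  spans_kernel D c.
Proof.
move=> r0 d0 -> wc Ab0 ker_b x; split; last first.
  case=> k ->; rewrite -scalemxAr; move/eqP: Ab0.
  rewrite linearZ /= -scalemxAr scalemx_eq0 (negPf d0) /= => /eqP ->.
  by rewrite scaler0.
case/ker_b => a ra; have {}ra i : r * x i 0 = a * d * c 0 i.
  by move/colP/(_ i): ra; rewrite !mxE mulrA.
exists (\sum_i w i * x i 0); apply/colP => i; rewrite !mxE.
apply: (mulfI r0); rewrite mulrA mulr_sumr ra; congr (_ * _).
under eq_bigr do rewrite mulrCA ra mulrCA.
by rewrite -mulr_sumr wc mulr1.
Qed.

(** * The kernel for two cycles glued at a vertex *)

Lemma incidence_off_cycle {s t : nat} {D : wograph s t} {k : nat}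
    {vs : 'I_k -> 'I_s} {es : 'I_k -> 'I_t} (hC : is_cycle D vs es)
    (x : 'I_s) (i : 'I_k) :
  (forall j, vs j != x) -> incidence D x (es i) = 0.
Proof.
case: hC => _ _ _ /(_ i) ends vsx; rewrite mxE.
have src_vs : src D (es i) \in [set vs i; vs (ordS i)] by rewrite -ends set21.
have tgt_vs : tgt D (es i) \in [set vs i; vs (ordS i)] by rewrite -ends set22.
have off y : y \in [set vs i; vs (ordS i)] -> (x == y) = false.
  by case/set2P => ->; rewrite eq_sym; apply: negbTE.
by rewrite !off.
Qed.

Section Glued.

Context {m n : nat} {hm : (2 < m)%N} {hn : (2 < n)%N}
  {D : wograph (m + n.-1) (m + n)}
  (hCm : is_cycle D (@vertex_Cm m n) (@edge_Cm m n))
  (hCn : is_cycle D (vertex_Cn hm hn) (@edge_Cn m n)).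

Local Notation Am := (cycle_incidence D (@vertex_Cm m n) (@edge_Cm m n)).
Local Notation An := (cycle_incidence D (vertex_Cn hm hn) (@edge_Cn m n)).
Local Notation i0 := (ord_first hm).
Local Notation j0 := (ord_first hn).

Lemma vertex_Cn_first : vertex_Cn hm hn j0 = lshift n.-1 i0.
Proof. by rewrite /vertex_Cn unlift_none. Qed.

Lemma vertex_Cn_lift (j : 'I_n.-1) : vertex_Cn hm hn (lift j0 j) = rshift m j.
Proof. by rewrite /vertex_Cn liftK. Qed.

(** Among the vertices of the first cycle, only the shared one meets edges of the second; hence the
    indicator. *)
Lemma glued_row_lshift (y : 'cV[int]_m) (z : 'cV[int]_n) (i : 'I_m) :
  (incidence D *m col_mx y z) (lshift n.-1 i) 0 =
  (Am *m y) i 0 + (i == i0)%:R * (An *m z) j0 0.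
Proof.
rewrite !mxE big_split_ord /= mulr_sumr; congr (_ + _); apply: eq_bigr => e _.
  by rewrite col_mxEu [in RHS]mxE.
rewrite col_mxEd [in RHS]mxE vertex_Cn_first; case: eqP => [->|/eqP ii0].
  by rewrite mul1r.
rewrite mul0r (incidence_off_cycle hCn) ?mul0r // => j.
case: (unliftP j0 j) => [j'|] ->.
  by rewrite vertex_Cn_lift eq_sym eq_lrshift.
by rewrite vertex_Cn_first eq_sym (inj_eq (@lshift_inj _ _)).
Qed.

Lemma glued_row_rshift (y : 'cV[int]_m) (z : 'cV[int]_n) (j : 'I_n.-1) :
  (incidence D *m col_mx y z) (rshift m j) 0 = (An *m z) (lift j0 j) 0.
Proof.
rewrite !mxE big_split_ord /= big1 => [|e _]; last first.
  rewrite (incidence_off_cycle hCm) ?mul0r // => i.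
  by rewrite eq_lrshift.
rewrite add0r; apply: eq_bigr => e _.
by rewrite col_mxEd [in RHS]mxE vertex_Cn_lift.
Qed.

Lemma glued_kernel (y : 'cV[int]_m) (z : 'cV[int]_n) :
  incidence D *m col_mx y z = 0 <->
  exists a : int,
    Am *m y = a *: delta_mx i0 0 /\ An *m z = - a *: delta_mx j0 0.
Proof.
split=> [Ax|[a [Amy Anz]]].
  have Axr r : (incidence D *m col_mx y z) r 0 = 0 by rewrite Ax mxE.
  exists ((Am *m y) i0 0); split; apply/colP => i.
    rewrite [RHS]mxE [X in _ * X]mxE eqxx andbT.
    have := Axr (lshift _ i); rewrite glued_row_lshift.
    by case: eqP => [->|_]; rewrite ?mulr1 // mul0r addr0 mulr0.
  rewrite [RHS]mxE [X in _ * X]mxE eqxx andbT.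
  case: (unliftP j0 i) => [j'|] ->.
    by rewrite -(glued_row_rshift y) Axr eq_sym (negPf (neq_lift _ _)) mulr0.
  have := Axr (lshift _ i0); rewrite glued_row_lshift !eqxx mul1r mulr1.
  by move/eqP; rewrite addrC addr_eq0 => /eqP.
apply/colP => r; rewrite [RHS]mxE; case: (split_ordP r) => i ->.
  rewrite glued_row_lshift Amy Anz !mxE !eqxx andbT.
  by case: eqP => _; rewrite /= ?mulr1 ?mul1r ?subrr // mulr0 mul0r addr0.
by rewrite glued_row_rshift Anz !mxE eq_sym (negPf (neq_lift _ _)) mulr0.
Qed.

(** A cycle matrix sends the first column of its adjugate to its determinant times the first unit
    vector; the crossed factors make the two contributions at the shared vertex cancel. *)
Lemma glued_kernel_adj :
  incidence D *m col_mx (\det An *: col i0 (\adj Am))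
                        (- \det Am *: col j0 (\adj An)) = 0.
Proof.
apply/glued_kernel; exists (\det An * \det Am).
rewrite -!scalemxAr !colE !mulmxA !mul_mx_adj !mul_scalar_mx !scalerA.
by rewrite mulNr mulrC.
Qed.

Lemma glued_kernel_line (x : 'cV[int]_(m + n)) :
  incidence D *m x = 0 ->
  exists a, (\det An * \det Am) *: x =
     a *: col_mx (\det An *: col i0 (\adj Am)) (- \det Am *: col j0 (\adj An)).
Proof.
rewrite -[x]vsubmxK => /glued_kernel [a [/(congr1 (mulmx (\adj Am))) y]].
move=> /(congr1 (mulmx (\adj An))) z; exists a.
move: y z; rewrite !mulmxA !mul_adj_mx !mul_scalar_mx -!scalemxAr -!colE => y z.
rewrite !scale_col_mx; congr col_mx.
  by rewrite -scalerA y !scalerA mulrC.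
by rewrite mulrC -scalerA z !scalerA; congr (_ *: _); ring.
Qed.

End Glued.

(** * Signs, gcd and the generator *)

Theorem theorem4p8 (K : fieldType) (m n : nat) (hm : (2 < m)%N) (hn : (2 < n)%N)
    (D : wograph (m + n.-1) (m + n))
    (hCm : is_cycle D (@vertex_Cm m n) (@edge_Cm m n))
    (hCn : is_cycle D (vertex_Cn hm hn) (@edge_Cn m n))
    (unbalCm : ~ balanced D (@vertex_Cm m n) (@edge_Cm m n))
    (unbalCn : ~ balanced D (vertex_Cn hm hn) (@edge_Cn m n)) :
  let Am := cycle_incidence D (@vertex_Cm m n) (@edge_Cm m n) in
  let An := cycle_incidence D (vertex_Cn hm hn) (@edge_Cn m n) in
  let Mm (i : 'I_m) := minor_del Am (ord_first hm) i in
  let Mn (i : 'I_n) := minor_del An (ord_first hn) i in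
  let p : int := \det An in
  let q : int := \det Am in
  (* i is 0-based, so the signs (-1)^(i+1), (-1)^i become (-1)^i, (-1)^(i+1) *)
  let b : 'rV[int]_(m + n) :=
    row_mx (\row_(i < m) ((-1) ^+ i * p * Mm i))
           (\row_(i < n) ((-1) ^+ i.+1 * q * Mn i)) in
  let d : int :=
    gcd_row (row_mx (\row_(i < m) (`|p| * Mm i)) (\row_(i < n) (`|q| * Mn i))) in
  exists c : 'rV[int]_(m + n),
    [/\ map_mx intr c = (d%:~R)^-1 *: map_mx intr b :> 'rV[rat]_(m + n),
        primitive_binomial D (binom_of K c)
      & forall P : {mpoly K[m + n]},
          P \in toric_ideal K D <-> principal_ideal (binom_of K c) P].
Proof.
move=> Am An Mm Mn p q b d.
pose b' : 'rV[int]_(m + n) :=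
  row_mx (\row_(i < m) (`|p| * Mm i)) (\row_(i < n) (`|q| * Mn i)).
have p0 : p != 0 by apply/eqP.
have q0 : q != 0 by apply/eqP.
(* The signed minors along the first row are cofactors, that is, the first column of the
   adjugate. *)
have bE : b^T = col_mx (p *: col (ord_first hm) (\adj Am))
                       (- q *: col (ord_first hn) (\adj An)).
  rewrite tr_row_mx; congr col_mx; apply/colP => i; rewrite !mxE /cofactor add0n.
    by rewrite mulrAC mulrC.
  by rewrite exprS mulN1r !mulNr mulrAC mulrC mulrA mulrAC.
(* If b vanished, so would the first adjugate column of [Am], and applying [Am] to it would give q =
   0. *)
have b0 : b != 0.
  apply: contra_neq q0 => b0.
  move: bE; rewrite b0 trmx0 -[LHS]col_mx0 => /eq_col_mx[/esym/eqP + _].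
  rewrite scalemx_eq0 (negPf p0) /= => /eqP adj0.
  have := congr1 (mulmx Am) adj0.
  rewrite colE mulmxA mul_mx_adj mul_scalar_mx mulmx0.
  by move/colP/(_ (ord_first hm)); rewrite !mxE !eqxx mulr1.
(* The vector b and the vector [b'] defining d differ only by these signs, so divisibility and
   Bezout relations transfer between them. *)
pose sgn : 'I_(m + n) -> int := fun i =>
  match split i with
  | inl i' => (-1) ^+ i' * Num.sg p
  | inr j' => (-1) ^+ j'.+1 * Num.sg q
  end.
have sgn_sqr i : sgn i * sgn i = 1.
  by rewrite /sgn; case: split => j;
    rewrite -expr2 exprMn sqrr_sign sqr_sg ?p0 ?q0.
have b'E i : b 0 i = sgn i * b' 0 i.
  rewrite /sgn !mxE; case: split => j; rewrite !mxE.
    by rewrite [in LHS](numEsg p) !mulrA.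
  by rewrite [in LHS](numEsg q) !mulrA.
have d0 : d != 0.
  apply: contra_neq b0 => d0; apply/rowP => i.
  have := gcd_row_dvd b' i; rewrite -/d d0 dvd0z b'E => /eqP ->.
  by rewrite mulr0 mxE.
pose c : 'rV[int]_(m + n) := \row_i (sgn i * (b' 0%R i %/ d)%Z).
have bc : b = d *: c.
  apply/rowP => i; rewrite b'E [RHS]mxE [c 0 i]mxE mulrCA [d * _]mulrC divzK //.
  exact: gcd_row_dvd.
have [w wb'] := gcd_row_bezout b'.
pose w' i := w i * sgn i.
have wc : \sum_i w' i * c 0 i = 1.
  apply: (mulfI d0); rewrite mulr1 mulr_sumr -[RHS]wb'; apply: eq_bigr => i _.
  have -> : d * (w' i * c 0 i) = w' i * b 0 i
    by rewrite bc [X in _ = _ * X]mxE mulrCA.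
  by rewrite b'E /w' mulrA -(mulrA (w i)) sgn_sqr mulr1.
have ker_c : spans_kernel D c.
  apply: (spans_kernel_primitive (b := b) d (p * q) w') => //.
  - by rewrite mulf_neq0.
  - by rewrite bE; apply: glued_kernel_adj.
  - by rewrite bE; apply: glued_kernel_line.
have c0 : c != 0.
  by apply: contra_neq b0 => c0; rewrite bc c0 scaler0.
exists c; split; last by move=> P; apply: toric_ideal_binom_of.
  by rewrite bc map_mxZ scalerA mulVf ?scale1r // intr_eq0.
exact: binom_of_primitive.
Qed.
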